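(* Let $d\ge 3$ and $m\ge 12d$ be integers, and let $$f_{d,m}(t)=(1+mt)^d=g_{d,m}(t)+t\,h_{d,m}(t)$$ be the recursive decomposition of $f_{d,m}(t)$, i.e. the one defined from the standard binomial expansions of the coefficients $c_i=\binom{d}{i}m^i$, $1\le i\le d$. Then each of the polynomials $g_{d,m}$ and $h_{d,m}$ has a pair of nonreal conjugate zeros (in $\mathbb C$).
   Context: Convention: for nonnegative integers $a,k$, $\binom{a}{k}=0$ if $a<k$ and $\binom{a}{0}=1$. Standard binomial expansion: for integers $i\ge 1$ and $c\ge 1$ there is a unique expansion (the standard $i$-th binomial expansion of $c$) $$c=\binom{a_i}{i}+\binom{a_{i-1}}{i-1}+\cdots+\binom{a_j}{j}$$ with integers $a_i>a_{i-1}>\cdots>a_j\ge j\ge 1$, $j\le i$; the integers $j,a_j,\dots,a_i$ depend on $c$ (and $i$). Recursive decomposition (Mu--Welker): let $d\ge1$ and $f(t)=1+\sum_{i=1}^d c_i t^i$ with all $c_i$ positive integers. For each $i\in\{1,\dots,d\}$ take separately the standard $i$-th binomial expansion $c_i=\sum_{r=j}^{i}\binom{a_r}{r}$ and set $$g_i=\sum_{r=j}^{i}\binom{a_r-1}{r},\qquad h_{i-1}=\sum_{r=j}^{i}\binom{a_r-1}{r-1}.$$ Define $g(t)=1+\sum_{i=1}^d g_i t^i$ and $h(t)=\sum_{i=1}^d h_{i-1}t^{i-1}$. Then $f(t)=g(t)+t\,h(t)$, and this is called the recursive decomposition of $f$. *)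

(* Defs.v *)
From mathcomp Require Export all_boot all_order all_algebra.
From mathcomp Require Export reals complex.

Set Implicit Arguments.
Unset Strict Implicit.
Unset Printing Implicit Defensive.

Import Order.TTheory GRing.Theory Num.Theory.

Local Open Scope ring_scope.

(* [std_binomial_expansion i c j a]: the standard i-th binomial expansion of c
   is 'C(a i, i) + 'C(a i.-1, i.-1) + ... + 'C(a j, j).  The values of a
   outside {j, ..., i} are irrelevant. *)
Definition std_binomial_expansion (i c j : nat) (a : nat -> nat) : Prop :=
  [/\ (1 <= j <= i)%N,
      (j <= a j)%N,
      (forall r : nat, (j <= r < i)%N -> (a r < a r.+1)%N) &
      c = (\sum_(j <= r < i.+1) 'C(a r, r))%N].

(* j i and a i are the data of the i-th expansion, taken separately for each i.
   Every a i r below is positive, so the truncated (a i r).-1 is the genuine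
   a i r - 1. *)
Definition recursive_decomposition (d : nat) (f g h : {poly int}) : Prop :=
  exists (c j : nat -> nat) (a : nat -> nat -> nat),
    [/\ f = 1 + \sum_(1 <= i < d.+1) (c i)%:R *: 'X^i,
        (forall i : nat, (1 <= i <= d)%N ->
           (0 < c i)%N /\ std_binomial_expansion i (c i) (j i) (a i)),
        g = 1 + \sum_(1 <= i < d.+1)
                  (\sum_(j i <= r < i.+1) 'C((a i r).-1, r))%N%:R *: 'X^i &
        h = \sum_(1 <= i < d.+1)
              (\sum_(j i <= r < i.+1) 'C((a i r).-1, r.-1))%N%:R *: 'X^(i.-1)].

Definition has_nonreal_conjugate_zeros (R : realType) (p : {poly int}) : Prop :=
  exists z : R[i],
    [/\ 'Im z != 0,
        root (map_poly intr p) z &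
        root (map_poly intr p) (z^*)].

(* Main.v *)
Require Import Defs.
From mathcomp Require Import boolp ring lra zify.

Set Implicit Arguments.
Unset Strict Implicit.
Unset Printing Implicit Defensive.

Import Order.TTheory GRing.Theory Num.Theory.

Local Open Scope ring_scope.

(* If all zeros of p with p(0) = 1 and degree at most n are real, then p is a
   product of n real factors 1 + x_k t.  Centring the x_k at their mean gives
   y_k with sum y_k^2 >= 0 and (sum y_k^3)^2 <= (sum y_k^2)^3, and both sums are
   polynomials in the first three coefficients of p.  For h the first inequality
   fails; for g the second does, because sum y_k^2 is at most m + 2 while
   |sum y_k^3| exceeds m^2 / 6.  Only an upper bound for h_1 ~ sqrt(d(d-1)) m
   and a lower bound for 2 h_2 ~ (d(d-1)(d-2))^(2/3) m^2 are needed. *)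

(** * Real-rooted polynomials and inequalities for power sums *)

(** Induction on [n]: a real zero [r], nonzero because p(0) = 1, splits off the factor 1 - t/r. *)
Lemma split_of_real_roots (R : rcfType) (n : nat) (p : {poly R}) :
  p`_0 = 1 -> (size p <= n.+1)%N ->
  (forall z : R[i], root (map_poly (real_complex R) p) z -> 'Im z = 0) ->
  exists2 s : seq R, size s = n & p = \prod_(x <- s) (1 + x *: 'X).
Proof.
elim: n p => [|n IHn] p p0 sp rp.
  by exists [::] => //; rewrite big_nil [p]size1_polyC // p0.
(* If the degree falls short of the bound, the list is padded with x = 0, whose factor is 1. *)
have [sp1|sp1] := leqP (size p) n.+1.
  have [s <- ->] := IHn p p0 sp1 rp.
  by exists (0 :: s) => //; rewrite big_cons scale0r addr0 mul1r.
have /closed_rootP[z pz] : size (map_poly (real_complex R) p) != 1.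
  by rewrite size_map_poly; apply/eqP => s1; move: sp1; rewrite s1; lia.
have [r zr] : exists r, z = real_complex R r.
  exists (complex.Re z); apply/eqP; rewrite eq_complex /= eqxx /=.
  have := rp z pz; rewrite -complexIm => -[->]; exact: eqxx.
move: (pz); rewrite zr fmorph_root => /factor_theorem[q pq].
have r_neq0 : r != 0.
  apply/eqP => r0; move: p0; rewrite pq r0 subr0 coefMX eqxx => /eqP.
  by rewrite eq_sym oner_eq0.
have pq' : p = (- r *: q) * (1 + (- r^-1) *: 'X).
  have rr : (- r)%:P * (- r^-1)%:P = 1 :> {poly R}.
    by rewrite -polyCM mulrNN mulfV.
  rewrite {1}pq -!mul_polyC -[r%:P]opprK -polyCN.
  move: (- r)%:P (- r^-1)%:P rr => a b ab.
  rewrite [RHS](_ : _ = a * q + a * b * (q * 'X)); last by ring.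
  by rewrite ab; ring.
have q0 : q != 0.
  by apply/eqP => q0; move/eqP: p0; rewrite pq q0 mul0r coef0 eq_sym oner_eq0.
have [|||s ss qs] := IHn (- r *: q).
- move: p0; rewrite {1}pq' coef0M coefD coef1.
  by rewrite [(_ *: 'X)`_0]coefZ coefX mulr0 addr0 mulr1.
- move: sp; rewrite pq size_Mmonic ?monicXsubC // size_XsubC addn2 /= ltnS.
  by rewrite size_scale // oppr_eq0.
- by move=> w qw; apply: rp; rewrite pq' rmorphM rootM qw.
by exists (- r^-1 :: s); rewrite /= ?ss // big_cons mulrC -qs.
Qed.

(** Newton's identities: the coefficients of [P] are the elementary symmetric functions of [s]. *)
Lemma coef_prod_linear (R : comNzRingType) (s : seq R) :
  let P := \prod_(x <- s) (1 + x *: 'X) in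
  let S (k : nat) := \sum_(x <- s) x ^+ k in
  [/\ P`_0 = 1, S 1%N = P`_1, S 2%N = P`_1 ^+ 2 - 2 * P`_2 &
      S 3%N = P`_1 ^+ 3 - 3 * (P`_1 * P`_2) + 3 * P`_3].
Proof.
rewrite /=; elim: s => [|x s [IH0 IH1 IH2 IH3]].
  by rewrite !big_nil !coef1 /=; split; ring.
rewrite !big_cons IH1 IH2 IH3 mulrDl mul1r -scalerAl.
by rewrite !coefD !coefZ !coefXM /= IH0; split; ring.
Qed.

Lemma sum_cubes_sqr_le (R : realFieldType) (s : seq R) :
  0 <= \sum_(x <- s) x ^+ 2 /\
  (\sum_(x <- s) x ^+ 3) ^+ 2 <= (\sum_(x <- s) x ^+ 2) ^+ 3.
Proof.
elim: s => [|x s [B0 AB]]; first by rewrite !big_nil !expr0n.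
rewrite !big_cons; set A := \sum_(_ <- _) _ ^+ 3 in AB *.
set B := \sum_(_ <- _) _ ^+ 2 in B0 AB *.
have x2 := sqr_ge0 x; split; first exact: addr_ge0.
(* By AM-GM, (2 A x)^2 <= 4 B^2 (B x^2) <= (B^2 + B x^2)^2. Multiplied by x^2, the root of this
   bounds the cross term 2 A x^3 of the induction step. *)
have sqAB : (2 * (A * x)) ^+ 2 <= (B ^+ 2 + B * x ^+ 2) ^+ 2.
  have : 0 <= (B ^+ 3 - A ^+ 2) * x ^+ 2 by rewrite mulr_ge0 // subr_ge0.
  have : 0 <= (B ^+ 2 - B * x ^+ 2) ^+ 2 by exact: sqr_ge0.
  by move=> *; lra.
have ABx : 2 * (A * x) <= B ^+ 2 + B * x ^+ 2.
  have BB : 0 <= B ^+ 2 + B * x ^+ 2.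
    by apply: addr_ge0; [exact: sqr_ge0 | exact: mulr_ge0].
  apply: le_trans (ler_norm _) _.
  by rewrite -ler_sqr ?nnegrE // real_normK ?num_real.
have := ler_wpM2r x2 ABx.
have : 0 <= B ^+ 2 * x ^+ 2 by rewrite mulr_ge0 ?sqr_ge0.
have : 0 <= B * x ^+ 4 by rewrite mulr_ge0 // exprn_even_ge0.
by move=> *; lra.
Qed.

(* V and W are the sums of the squares and cubes of the centred y_k. *)
Lemma real_rooted_ineq (R : rcfType) (n : nat) (p : {poly R}) :
  (0 < n)%N -> p`_0 = 1 -> (size p <= n.+1)%N ->
  (forall z : R[i], root (map_poly (real_complex R) p) z -> 'Im z = 0) ->
  let V := (1 - n%:R^-1) * p`_1 ^+ 2 - 2 * p`_2 in
  let W := (1 - 3 / n%:R + 2 / n%:R ^+ 2) * p`_1 ^+ 3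
           + (6 / n%:R - 3) * (p`_1 * p`_2) + 3 * p`_3 in
  0 <= V /\ W ^+ 2 <= V ^+ 3.
Proof.
move=> n0 p0 sp rp V W.
have [s ss ps] := split_of_real_roots p0 sp rp.
have [_ S1 S2 S3] := coef_prod_linear s; rewrite -ps /= in S1 S2 S3.
pose mu := p`_1 / n%:R.
have nn : n%:R != 0 :> R by rewrite pnatr_eq0 -lt0n.
have S1' : \sum_(x <- s) x = p`_1 by rewrite -S1.
have S0 : \sum_(x <- s) 1 = n%:R :> R.
  by rewrite big_const_seq count_predT iter_addr_0 ss.
have := sum_cubes_sqr_le [seq x - mu | x <- s]; rewrite !big_map.
have -> : \sum_(x <- s) (x - mu) ^+ 2 = V.
  transitivity (\sum_(x <- s) (x ^+ 2 + (- (2 * mu) * x + mu ^+ 2 * 1))).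
    by apply: eq_bigr => x _; ring.
  rewrite !big_split /= -!mulr_sumr S2 S1' S0 /V /mu; field; exact: nn.
have -> : \sum_(x <- s) (x - mu) ^+ 3 = W.
  transitivity (\sum_(x <- s) (x ^+ 3 + (- (3 * mu) * x ^+ 2
      + (3 * mu ^+ 2 * x + - mu ^+ 3 * 1)))).
    by apply: eq_bigr => x _; ring.
  rewrite !big_split /= -!mulr_sumr S3 S2 S1' S0 /W /mu; field; exact: nn.
by [].
Qed.

(** The last hypothesis negates the conjunction in [real_rooted_ineq], so it covers both V < 0 and
    V^3 < W^2. The conjugate of a nonreal zero is a zero because the coefficients are real. *)
Lemma nonreal_zeros_of_ineq (R : realType) (n : nat) (p : {poly int}) :
  (0 < n)%N -> p`_0 = 1 -> (size p <= n.+1)%N ->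
  let q i : R := (p`_i)%:~R in
  let V := (1 - n%:R^-1) * q 1 ^+ 2 - 2 * q 2 in
  let W := (1 - 3 / n%:R + 2 / n%:R ^+ 2) * q 1 ^+ 3
           + (6 / n%:R - 3) * (q 1 * q 2) + 3 * q 3 in
  (0 <= V -> V ^+ 3 < W ^+ 2) -> has_nonreal_conjugate_zeros R p.
Proof.
move=> n0 p0 sp q V W VW; apply: contrapT => np.
have pRC : map_poly intr p =
    map_poly (real_complex R) (map_poly intr p) :> {poly R[i]}.
  by rewrite -map_poly_comp /=; apply: eq_map_poly => k /=; rewrite rmorph_int.
have := @real_rooted_ineq R n (map_poly intr p) n0.
rewrite !coef_map /= -/(q 1) -/(q 2) -/(q 3) p0 -/V -/W => /(_ erefl).
case=> [||V0]; last by rewrite leNgt VW.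
  by apply: leq_trans sp; exact: size_poly.
move=> z; rewrite -pRC => pz; apply/eqP; apply: contra_notT np => zn.
exists z; split=> //.
have -> : z^* = conjc z by [].
rewrite -complex_root_conj pRC -map_poly_comp.
rewrite (_ : map_poly _ _ = map_poly (real_complex R) (map_poly intr p)).
  by rewrite -pRC.
by apply: eq_map_poly => k /=; rewrite oppr0.
Qed.

(** * Real estimates, with e = d - 1 and w = 1 / e *)

Lemma inverse_bounds (R : realFieldType) (e w : R) :
  2 <= e -> e * w = 1 -> 0 < w /\ w <= 1 / 2.
Proof. by move=> e2 ew; split; nra. Qed.

(* With e = d - 1 and w = 1 / e: sqrt(e (e + 1)) = e + 1/2 - w/8 + ..., and
   1/10 is a weakening of 1/8 that leaves room for the error terms. *)
Lemma real_quadratic_upper (R : realFieldType) (e m h w : R) :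
  2 <= e -> 12 * (e + 1) <= m -> e * w = 1 ->
  h * (h - 1) <= e * (e + 1) * m ^+ 2 -> h <= m * (e + 1 / 2 - w / 10) + 1 / 2.
Proof.
move=> e2 m12 ew hh; rewrite leNgt; apply/negP => hU.
have [w0 w2] := inverse_bounds e2 ew.
set v := m * (e + 1 / 2 - w / 10) in hU.
have v0 : 0 < v by rewrite mulr_gt0; lra.
have hv : v ^+ 2 < (h - 1 / 2) ^+ 2 by rewrite ltr_pXn2r ?nnegrE //; lra.
(* Completing the square gives (h - 1/2)^2 <= e (e + 1) m^2 + 1/4. The excess of v^2 over e (e + 1)
   m^2 is at least 36^2 / 400 > 1/4: 36 is 12 (e + 1) at e = 2, and 1/400 is the value of the
   bracket at w = 1/2. *)
have m2 : 36 ^+ 2 <= m ^+ 2 by rewrite lerXn2r ?nnegrE //; lra.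
have k : 1 / 400 <= 1 / 20 - w / 10 + (w / 10) ^+ 2 by nra.
have vE : v ^+ 2 = e * (e + 1) * m ^+ 2
    + m ^+ 2 * (1 / 20 - w / 10 + (w / 10) ^+ 2).
  rewrite (_ : v ^+ 2 = m ^+ 2 * ((e + 1 / 2) ^+ 2 - (e * w) / 5 - w / 10
    + (w / 10) ^+ 2)); last by rewrite /v; field.
  by rewrite ew; field.
have : 36 ^+ 2 * (1 / 400) <= m ^+ 2 * (1 / 20 - w / 10 + (w / 10) ^+ 2).
  by apply: ler_pM => //; lra.
by move=> ?; lra.
Qed.

(* The tangent bound u^3 + 3 b (b + 3) <= (u + s)^3 with u^2 s = b (b + 3) turns
   the hypothesis on c into X <= u + s. *)
Lemma real_cubic_lower (R : realFieldType) (u b h X c : R) :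
  0 <= b -> b + 1 <= u -> 1 / 2 <= X -> X ^+ 3 <= c ->
  c + u <= u ^+ 3 + 3 * (b * (b + 3)) -> u * (u - 1) + 2 * b <= 2 * h ->
  X * (X - 1) - 5 <= 2 * h.
Proof.
move=> b0 bu X2 Xc cu uh.
have u_gt0 : 0 < u by lra.
have u0 : u != 0 by rewrite gt_eqF.
pose s := b * (b + 3) / u ^+ 2.
have us : u ^+ 2 * s = b * (b + 3) by rewrite /s; field.
have s0 : 0 <= s by rewrite /s !mulr_ge0 ?invr_ge0 ?exprn_ge0; lra.
have Xus : X <= u + s.
  rewrite -(@ler_pXn2r _ 3) ?nnegrE //; try lra.
  have : 0 <= u * s ^+ 2 by rewrite mulr_ge0 ?sqr_ge0; lra.
  have : 0 <= s ^+ 3 by exact: exprn_ge0.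
  by move=> ? ?; nra.
(* From b <= u - 1, b (b + 3) <= u^2 + u - 2, which is 9/8 u^2 - (u - 4)^2 / 8. *)
have s98 : s <= 9 / 8.
  rewrite -(ler_pM2l (exprn_gt0 2 u_gt0)) us.
  by have := sqr_ge0 (u - 4); nra.
have sb : (2 * u - 1) * s <= 2 * b + 3.
  rewrite -(ler_pM2l (exprn_gt0 2 u_gt0)).
  have -> : u ^+ 2 * ((2 * u - 1) * s) = (2 * u - 1) * (u ^+ 2 * s) by ring.
  rewrite us.
  have : 0 <= (2 * u - 1) * (b * (u - 1 - b)) by rewrite !mulr_ge0; lra.
  by move=> ?; nra.
have s2 : s ^+ 2 <= 2 by nra.
(* t (t - 1) increases for t >= 1/2. The loss of 5 is the 3 of [sb] plus the 2 of [s2]. *)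
have : X * (X - 1) <= (u + s) * (u + s - 1) by nra.
by move=> ?; lra.
Qed.

(* (e^3 - e)^(1/3) = e - w/3 - ..., whence the weakening 3/8 of 1/3. *)
Lemma cube_root_lower (R : realFieldType) (e m w : R) :
  2 <= e -> 12 * (e + 1) <= m -> e * w = 1 ->
  let X := m * (e - 3 / 8 * w) in
  1 / 2 <= X /\ X ^+ 3 <= e * (e + 1) * (e - 1) * m ^+ 3.
Proof.
move=> e2 m12 ew X; have [w0 w2] := inverse_bounds e2 ew.
split; first by rewrite /X; nra.
rewrite /X exprMn mulrC ler_pM2r; last by apply: exprn_gt0; lra.
rewrite (_ : _ ^+ 3 = e ^+ 3 - 9 / 8 * e * (e * w) + 27 / 64 * w * (e * w)
   - 27 / 512 * w ^+ 3); last by field.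
have : 0 < w ^+ 3 by exact: exprn_gt0.
by rewrite ew => ?; nra.
Qed.

Lemma cube_root_quadratic (R : realFieldType) (e m w : R) : e * w = 1 ->
  let X := m * (e - 3 / 8 * w) in
  X * (X - 1) = m ^+ 2 * (e ^+ 2 - 3 / 4 + 9 / 64 * w ^+ 2)
    - m * e + 3 / 8 * m * w.
Proof.
move=> ew X; rewrite (_ : X * (X - 1) = m ^+ 2 * (e ^+ 2 - 3 / 4 * (e * w)
  + 9 / 64 * w ^+ 2) - m * e + 3 / 8 * m * w); first by rewrite ew mulr1.
by rewrite /X; field.
Qed.

(** Since (1 - w) e (e + 1) = e^2 - 1 while X^2 contributes at least (e^2 - 3/4) m^2, the quadratic
    terms leave at most -m^2 / 4 <= -3 m (e + 1), which outweighs the linear terms, about 2 e m. *)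
Lemma h_variance_lt0 (R : realFieldType) (e m w h1 h2 : R) :
  2 <= e -> 12 * (e + 1) <= m -> e * w = 1 ->
  let U := m * (e + 1 / 2 - w / 10) + 1 / 2 in
  let X := m * (e - 3 / 8 * w) in
  h1 <= U -> X * (X - 1) - 5 <= 2 * h2 ->
  h1 * (h1 - 1) <= e * (e + 1) * m ^+ 2 ->
  (1 - w) * h1 ^+ 2 - 2 * h2 < 0.
Proof.
move=> e2 m12 ew U X h1U Xh2 hh; have [w0 w2] := inverse_bounds e2 ew.
have : (1 - w) * h1 ^+ 2 <= (1 - w) * (e * (e + 1) * m ^+ 2 + U).
  by rewrite ler_pM2l; lra.
have XE := cube_root_quadratic m ew; rewrite -/X in XE.
have VE : (1 - w) * (e * (e + 1) * m ^+ 2 + U) =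
    m ^+ 2 * (e ^+ 2 - 1) + m * (e - 1 / 2 - 6 / 10 * w + w ^+ 2 / 10)
    + 1 / 2 - w / 2.
  rewrite (_ : (1 - w) * (e * (e + 1) * m ^+ 2 + U) =
    m ^+ 2 * (e ^+ 2 + e - (e * w) * (e + 1))
    + m * (e + 1 / 2 - e * w - 6 / 10 * w + w ^+ 2 / 10) + 1 / 2 - w / 2).
    by rewrite ew; field.
  by rewrite /U; field.
have m2 : 0 <= m * (m - 12 * (e + 1)) by rewrite mulr_ge0; lra.
have em : 0 <= m * (e - 2) by rewrite mulr_ge0; lra.
have mw : 0 <= m * w by rewrite mulr_ge0; lra.
have mw2 : 0 <= m * (1 / 4 - w ^+ 2) by rewrite mulr_ge0 //; [lra | nra].
have m2w2 : 0 <= m ^+ 2 * w ^+ 2 by rewrite mulr_ge0 ?sqr_ge0.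
by move: Xh2; rewrite XE VE => ? ?; lra.
Qed.

Lemma g_skewness (R : realFieldType) (e m w h1 h2 : R) :
  2 <= e -> 12 * (e + 1) <= m -> e * w = 1 ->
  let U := m * (e + 1 / 2 - w / 10) + 1 / 2 in
  let X := m * (e - 3 / 8 * w) in
  0 <= h1 -> h1 <= U -> X * (X - 1) - 5 <= 2 * h2 ->
  let d := e + 1 in
  let g1 := d * m - 1 in
  let g2 := d * e / 2 * m ^+ 2 - h1 in
  let g3 := d * e * (e - 1) / 6 * m ^+ 3 - h2 in
  let V := (1 - d^-1) * g1 ^+ 2 - 2 * g2 in
  let W := (1 - 3 / d + 2 / d ^+ 2) * g1 ^+ 3 + (6 / d - 3) * (g1 * g2)
           + 3 * g3 in
  0 <= V -> V ^+ 3 < W ^+ 2.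
Proof.
move=> e2 m12 ew U X h10 h1U Xh2 d g1 g2 g3 V W V0.
have [w0 w2] := inverse_bounds e2 ew.
have d0 : d != 0 by rewrite gt_eqF // /d; lra.
pose v := d^-1.
have v0 : 0 < v by rewrite invr_gt0 /d; lra.
have dv : (e + 1) * v = 1 by exact: mulfV.
have v3 : v <= 1 / 3 by nra.
(* The coefficients of (1 + m t)^d alone give V = 0, as all x_k are then equal; only the corrections
   by 1 and [h1] remain. *)
have VE : V = 2 * h1 - 2 * e * m + e * v.
  by rewrite /V /g1 /g2 /v /d; field.
have Vm : V <= m + 2.
  have mw : 0 <= m * w by rewrite mulr_ge0; lra.
  by rewrite VE; move: h1U; rewrite /U; lra.
pose G := - e * (e - 1) * m ^+ 2 + 2 * m * e * (e - 1) * v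
  - 2 / 3 * e * (e - 1) * v ^+ 2 + 2 * (e - 1) * (m - v) * h1 - 2 * h2.
have WE : W = 3 / 2 * G by rewrite /W /G /g1 /g2 /g3 /v /d; field.
(* The m^2 terms add up to -(9/20 - w/5 + 9/64 w^2). A part 1/9 is kept, and the rest pays for the
   linear terms. *)
have Gm : G <= - (m ^+ 2 / 9 + 4 * m).
  have XE := cube_root_quadratic m ew; rewrite -/X in XE.
  have UE : (e - 1) * m * U = m ^+ 2 * (e ^+ 2 - e / 2 - 6 / 10 + w / 10)
      + m * (e - 1) / 2.
    rewrite (_ : (e - 1) * m * U = m ^+ 2 * (e ^+ 2 - e / 2 - 1 / 2
      - e * w / 10 + w / 10) + m * (e - 1) / 2); last by rewrite /U; field.
    by rewrite ew; field.
  have vE : e * (e - 1) * v = e - 2 + 2 * v.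
    rewrite (_ : e * (e - 1) * v = (e + 1) * v * (e - 2) + 2 * v); last by ring.
    by rewrite dv mul1r.
  have h1m : (e - 1) * (m - v) * h1 <= (e - 1) * m * U.
    by apply: ler_pM => //; nra.
  have v2 : 0 <= e * (e - 1) * v ^+ 2 by rewrite !mulr_ge0 ?sqr_ge0; lra.
  have : G <= - e * (e - 1) * m ^+ 2 + 2 * m * (e * (e - 1) * v)
      + 2 * ((e - 1) * m * U) - X * (X - 1) + 5.
    by rewrite /G; lra.
  rewrite UE XE vE.
  have k0 : 0 <= 9 / 20 - 1 / 9 - w / 5 + 9 / 64 * w ^+ 2 by nra.
  (* One factor m is replaced by 12 (e + 1). The resulting coefficient 12 * 61/180 = 61/15 of m e
     just exceeds the 4 of the linear terms. *)
  have mk : 12 * m * (61 / 180 * e + 5 / 36 - 19 / 320 * w + 9 / 64 * w ^+ 2)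
      <= m ^+ 2 * (9 / 20 - 1 / 9 - w / 5 + 9 / 64 * w ^+ 2).
    rewrite (_ : 12 * m * _ = m * (12 * (e + 1))
      * (9 / 20 - 1 / 9 - w / 5 + 9 / 64 * w ^+ 2)).
      by apply: ler_wpM2r => //; rewrite expr2; apply: ler_wpM2l; lra.
    rewrite [RHS](_ : _ = 12 * m * (61 / 180 * e + 61 / 180 - e * w / 5 - w / 5
      + 9 / 64 * (e * w) * w + 9 / 64 * w ^+ 2)); last by field.
    by rewrite ew; field.
  have em : 0 <= m * (e - 2) by rewrite mulr_ge0; lra.
  have mw : 0 <= m * (1 / 2 - w) by rewrite mulr_ge0; lra.
  have mw' : 0 <= m * w by rewrite mulr_ge0; lra.
  have mv : 0 <= m * (1 / 3 - v) by rewrite mulr_ge0; lra.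
  have mw2 : 0 <= m * w ^+ 2 by rewrite mulr_ge0 ?sqr_ge0; lra.
  by move=> ?; lra.
(* Both sides of [Gm] are negative, so squaring reverses it. *)
have GW : (3 / 2 * (m ^+ 2 / 9 + 4 * m)) ^+ 2 <= W ^+ 2.
  rewrite WE -[X in _ <= X]sqrrN lerXn2r ?nnegrE //; try lra; nra.
have Vm3 : V ^+ 3 <= (m + 2) ^+ 3 by rewrite lerXn2r ?nnegrE //; lra.
apply: le_lt_trans Vm3 (lt_le_trans _ GW).
have -> : (3 / 2 * (m ^+ 2 / 9 + 4 * m)) ^+ 2 =
  m ^+ 4 / 36 + 2 * m ^+ 3 + 36 * m ^+ 2 by field.
have m0 : 0 < m by lra.
have : 0 < m ^+ 3 by exact: exprn_gt0.
have : 0 < m ^+ 4 by exact: exprn_gt0.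
have : 0 <= m * (m - 1) by nra.
by move=> ? ? ?; nra.
Qed.

(** * Binomial expansions for i <= 3 *)

Lemma bin2S u : (2 * 'C(u.+1, 2) = u * u + u)%N.
Proof. by rewrite -mul_bin_diag bin1 /=; lia. Qed.

Lemma bin3S u : (6 * 'C(u.+1, 3) + u = u ^ 3)%N.
Proof.
elim: u => // u IHu; rewrite binS; have := bin2S u.
rewrite !expnS expn0 in IHu *; nia.
Qed.

(* For the i-th expansion this is the paper's h_{i-1}. *)
Definition hcoef (i j : nat) (a : nat -> nat) : nat :=
  (\sum_(j <= r < i.+1) 'C((a r).-1, r.-1))%N.

(** With [a 2] = u + 1, the sum is u + 1 or u according to whether the term r = 1 occurs; either way
    h (h - 1) <= u (u + 1) = 2 'C(u + 1, 2). *)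
Lemma hcoef2_upper c j a : std_binomial_expansion 2 c j a ->
  (hcoef 2 j a * hcoef 2 j a <= 2 * c + hcoef 2 j a)%N.
Proof.
case=> /andP[j1 j2] ja amon ->; rewrite /hcoef.
case: j j1 j2 ja amon => // -[|[|//]] _ _ ja amon.
- rewrite unlock /= !addn0 bin0 !bin1.
  have := amon 1%N isT; case: (a 2%N) => // u _.
  by have := bin2S u; rewrite /= => ?; lia.
- rewrite unlock /= !addn0 bin1; case: (a 2%N) ja => // u _.
  by have := bin2S u; rewrite /= => ?; lia.
Qed.

(* u = a_3 - 1, and b = a_2 - 1 when a_2 occurs in the expansion. *)
Lemma hcoef3_lower c j a : std_binomial_expansion 3 c j a ->
  exists u b : nat, [/\ (b < u)%N,
    (6 * c + u <= u ^ 3 + 3 * (b * (b + 3)))%N &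
    (u * u + 2 * b <= 2 * hcoef 3 j a + u)%N].
Proof.
case=> /andP[j1 j3] ja amon ->; rewrite /hcoef.
have sq n : (2 * 'C(n, 2) + n = n * n)%N.
  by case: n => // n; have := bin2S n; lia.
case: j j1 j3 ja amon => // -[|[|[|//]]] _ _ ja amon.
- have := amon 1%N isT; have := amon 2%N isT; rewrite unlock /= !addn0.
  rewrite bin0 !bin1; case: (a 2%N) => // b; case: (a 3%N) => // u bu ab.
  (* Since [a 1] <= b, the lower terms satisfy 6 'C(b + 1, 2) + 6 (a 1) <= 3 b (b + 3). *)
  exists u, b; have := bin2S b; have := bin3S u; have := sq u.
  by split; rewrite /=; lia.
- have := amon 2%N isT; rewrite unlock /= !addn0.
  rewrite !bin1; case: (a 2%N) ja => // b _; case: (a 3%N) => // u bu.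
  exists u, b; have := bin2S b; have := bin3S u; have := sq u.
  by split; rewrite /=; lia.
- rewrite unlock /= !addn0; case: (a 3%N) ja => // u u2.
  exists u, 0%N; have := bin3S u; have := sq u.
  by split; rewrite /=; lia.
Qed.

Lemma hcoef1 c j a : std_binomial_expansion 1 c j a -> hcoef 1 j a = 1%N.
Proof.
by case=> j1 _ _ _; have -> : j = 1%N by [lia]; rewrite /hcoef big_nat1 bin0.
Qed.

(** Pascal's rule term by term, that is f = g + t h; it needs [a r] > 0 so that the predecessor is
    not truncated. *)
Lemma gcoefE i c j a : std_binomial_expansion i c j a ->
  (\sum_(j <= r < i.+1) 'C((a r).-1, r) + hcoef i j a)%N = c.
Proof.
case=> /andP[j1 ji] ja amon ->; rewrite -big_split /=.
apply: eq_big_nat => r /andP[jr ri].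
have ar : (0 < a r)%N.
  have [->|jr'] := eqVneq r j; first by lia.
  have r1 : r.-1.+1 = r by lia.
  by have := amon r.-1; rewrite r1 => /(_ ltac:(lia)); lia.
by case: r (a r) jr ar {ri} => [|r] [|n] jr ar; rewrite ?binS /=; lia.
Qed.

(** * Coefficients of g and h *)

Lemma sum_shift_poly (R : nzRingType) (n : nat) (F : nat -> R) :
  \sum_(1 <= i < n.+1) F i *: 'X^(i.-1) = \poly_(i < n) F i.+1.
Proof. by rewrite big_add1 big_mkord poly_def. Qed.

Lemma one_add_sum_poly (R : nzRingType) (n : nat) (F : nat -> R) :
  1 + \sum_(1 <= i < n.+1) F i *: 'X^i =
  \poly_(i < n.+1) (if i == 0 then 1 else F i).
Proof.
pose G i := (if i == 0 then 1 else F i) *: 'X^i.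
rewrite poly_def -(big_mkord xpredT G) /G.
rewrite big_ltn // scale1r expr0; congr (_ + _).
by apply: eq_big_nat => -[|i].
Qed.

Lemma linear_exp_poly (R : comNzRingType) (m : R) (n : nat) :
  (1 + m *: 'X) ^+ n = \poly_(i < n.+1) (m ^+ i *+ 'C(n, i)).
Proof.
rewrite exprDn poly_def; apply: eq_bigr => i _.
by rewrite expr1n mul1r exprZn scalerMnl.
Qed.

(** Collects all that the real estimates use: each g_i is c_i - h_{i-1}, h_0 = 1, and h_1, h_2 are
    bounded through the expansions for i = 2, 3. *)
Lemma decomposition_coefs (e m : nat) (g h : {poly int}) :
  (2 <= e)%N -> recursive_decomposition e.+1 ((1 + m%:R *: 'X) ^+ e.+1) g h ->
  exists h1 h2 : nat,
  [/\ [/\ (size g <= e.+2)%N, g`_0 = 1, g`_1 = (e.+1 * m)%:Z - 1,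
          g`_2 = ('C(e.+1, 2) * m ^ 2)%:Z - h1%:Z &
          g`_3 = ('C(e.+1, 3) * m ^ 3)%:Z - h2%:Z],
      [/\ (size h <= e.+1)%N, h`_0 = 1, h`_1 = h1%:Z & h`_2 = h2%:Z],
      (h1 * h1 <= 2 * ('C(e.+1, 2) * m ^ 2) + h1)%N &
      exists u b : nat, [/\ (b < u)%N,
        (6 * ('C(e.+1, 3) * m ^ 3) + u <= u ^ 3 + 3 * (b * (b + 3)))%N &
        (u * u + 2 * b <= 2 * h2 + u)%N]].
Proof.
move=> e2 [c [j [a [fE cE -> ->]]]].
have exp i : (1 <= i <= e.+1)%N -> std_binomial_expansion i (c i) (j i) (a i).
  by move=> /cE[].
have cf i : (1 <= i <= e.+1)%N -> c i = ('C(e.+1, i) * m ^ i)%N.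
  move=> /andP[i1 ie]; have := congr1 (fun p : {poly int} => p`_i) fE.
  rewrite linear_exp_poly one_add_sum_poly !coef_poly ltnS ie.
  by rewrite (gtn_eqF i1) -natrX -mulr_natl -natrM !natz => -[<-].
have gE i : (1 <= i <= e.+1)%N ->
    (\sum_(j i <= r < i.+1) 'C((a i r).-1, r))%N%:R =
    ('C(e.+1, i) * m ^ i)%:Z - (hcoef i (j i) (a i))%:Z.
  by move=> ie; rewrite -(cf i ie) -(gcoefE (exp i ie)) natz PoszD addrK.
exists (hcoef 2 (j 2%N) (a 2%N)), (hcoef 3 (j 3%N) (a 3%N)).
have i1 : (1 <= 1 <= e.+1)%N by lia.
have i2 : (1 <= 2 <= e.+1)%N by lia.
have i3 : (1 <= 3 <= e.+1)%N by lia.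
rewrite one_add_sum_poly sum_shift_poly; split.
- split; rewrite ?size_poly // coef_poly.
  + by [].
  + by rewrite !ltnS gE // (hcoef1 (exp 1%N i1)) bin1 expn1 /=.
  + by rewrite !ltnS gE //; case: ifP => //; lia.
  + by rewrite !ltnS gE //; case: ifP => //; lia.
- split; rewrite ?size_poly // coef_poly.
  + by rewrite -[X in X%:R]/(hcoef 1 (j 1%N) (a 1%N)) (hcoef1 (exp 1%N i1)).
  + by rewrite natz ltnS; case: ifP => //; lia.
  + by rewrite natz !ltnS; case: ifP => //; lia.
- by rewrite -cf //; apply: hcoef2_upper; exact: exp.
- by rewrite -cf //; apply: (@hcoef3_lower _ (j 3%N)); exact: exp.
Qed.

Theorem theorem1p2 (R : realType) (d m : nat) (g h : {poly int})
    (hd : (3 <= d)%N) (hm : (12 * d <= m)%N)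
    (hgh : recursive_decomposition d ((1 + m%:R *: 'X) ^+ d) g h) :
  has_nonreal_conjugate_zeros R g /\ has_nonreal_conjugate_zeros R h.
Proof.
case: d hd hm hgh => // e; rewrite ltnS => e2 m12 /(decomposition_coefs e2).
case=> h1 [h2 [[sg g0 g1 g2 g3] [sh h0 h1E h2E] hh1 [u [b [bu cu uh]]]]].
pose E : R := e%:R; pose M : R := m%:R; pose w := E^-1.
have E2 : 2 <= E by rewrite ler_nat.
have M12 : 12 * (E + 1) <= M by rewrite natr1 -natrM ler_nat.
have Ew : E * w = 1 by rewrite mulfV // gt_eqF //; lra.
have c2 : ('C(e.+1, 2))%:R = (E + 1) * E / 2 :> R.
  have /(congr1 (fun n => n%:R : R)) := bin2S e.
  by rewrite natrD !natrM -/E; lra.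
have c3 : ('C(e.+1, 3))%:R = (E + 1) * E * (E - 1) / 6 :> R.
  have /(congr1 (fun n => n%:R : R)) := bin3S e.
  by rewrite natrD natrM natrX -/E; lra.
have hh : h1%:R * (h1%:R - 1) <= E * (E + 1) * M ^+ 2.
  have : (h1 * h1)%:R <= (2 * ('C(e.+1, 2) * m ^ 2) + h1)%:R :> R.
    by rewrite ler_nat.
  by rewrite natrD !natrM c2 -/M; lra.
have hU := real_quadratic_upper E2 M12 Ew hh.
have [X2 X3] := cube_root_lower E2 M12 Ew.
have hX : M * (E - 3 / 8 * w) * (M * (E - 3 / 8 * w) - 1) - 5 <= 2 * h2%:R.
  apply: (@real_cubic_lower R u%:R b%:R _ _ _ _ _ X2 X3).
  - exact: ler0n.
  - by rewrite natr1 ler_nat.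
  - have : 6 * ('C(e.+1, 3)%:R * M ^+ 3) + u%:R
      <= u%:R ^+ 3 + 3 * (b%:R * (b%:R + 3)) :> R.
      by rewrite /M -!(natrX, natrM, natrD) ler_nat.
    by rewrite c3; lra.
  - have : (u * u + 2 * b)%:R <= (2 * h2 + u)%:R :> R by rewrite ler_nat.
    by rewrite !(natrD, natrM); lra.
split.
- apply: (nonreal_zeros_of_ineq (n := e.+1)) => //.
  rewrite g1 g2 g3 !rmorphB /= -!pmulrn.
  rewrite natrM [X in X - h1%:R]natrM [X in X - h2%:R]natrM !natrX c2 c3.
  rewrite -natr1 -/E -/M.
  exact: (g_skewness E2 M12 Ew (ler0n R h1) hU hX).
(* The degree bound for h is d - 1 = [e], so 1 / n is [w]; here V < 0 refutes the premise 0 <= V. *)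
- apply: (nonreal_zeros_of_ineq (n := e)); rewrite ?(ltn_trans _ e2) //.
  rewrite h1E h2E -!pmulrn -/E -/w leNgt.
  by rewrite (h_variance_lt0 E2 M12 Ew hU hX hh).
Qed.
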